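(* Let $\Gamma$ be a finitely generated, amenable (discrete) group. Then $\Gamma$ has a nontrivial, orientation-preserving action on the real line $\mathbb{R}$ if and only if $\Gamma$ has an infinite cyclic quotient.
   Context: A discrete group $\Gamma$ is amenable iff for every continuous action of $\Gamma$ on a compact Hausdorff space $X$, there is a $\Gamma$-invariant (Borel) probability measure on $X$. An orientation-preserving action on $\mathbb{R}$ is an action by orientation-preserving (i.e. increasing) homeomorphisms; it is nontrivial if some element of $\Gamma$ acts as a non-identity homeomorphism. $\Gamma$ has an infinite cyclic quotient iff there is a surjective homomorphism $\Gamma \to \mathbb{Z}$. *)

(* Defs.v *)
From mathcomp Require Import all_boot all_order all_algebra.
From mathcomp Require Import all_classical all_reals all_analysis.

Set Implicit Arguments.
Unset Strict Implicit.
Unset Printing Implicit Defensive.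

Import Order.TTheory GRing.Theory Num.Theory.
Import numFieldNormedType.Exports.

Local Open Scope classical_set_scope.
Local Open Scope ring_scope.

Definition subgroup_generated (G : groupType) (A : set G) : set G :=
  smallest (fun S : set G => group_closed [in S]) A.

Definition finitely_generated (G : groupType) : Prop :=
  exists2 A : set G, finite_set A & subgroup_generated A = [set: G].

Definition is_left_action (G : groupType) (X : Type) (act : G -> X -> X) : Prop :=
  (forall x, act 1%g x = x) /\
  (forall g h x, act (g * h)%g x = act g (act h x)).

(* [G] is discrete, so joint continuity of [G * X -> X] amounts to the
   continuity of each [act g]; each [act g] is then a homeomorphism, with
   inverse [act g^-1]. *)
Definition is_continuous_action (G : groupType) (X : topologicalType)
    (act : G -> X -> X) : Prop :=
  is_left_action act /\ (forall g, continuous (act g)).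

Definition invariant_measure (R : realType) (G : groupType) d
    (X : measurableType d) (act : G -> X -> X)
    (mu : {measure set X -> \bar R}) : Prop :=
  forall g (A : set X), measurable A -> mu (act g @^-1` A) = mu A.

Definition borelType (X : ptopologicalType) := g_sigma_algebraType (@open X).

(* A [ptopologicalType] is pointed: [X] ranges over the nonempty spaces, the
   empty one carrying no probability measure. *)
Definition amenable (R : realType) (G : groupType) : Prop :=
  forall (X : ptopologicalType) (act : G -> X -> X),
    compact [set: X] -> hausdorff_space X -> is_continuous_action act ->
    exists mu : probability (borelType X) R,
      @invariant_measure R G _ (borelType X) act mu.

Definition is_orientation_preserving_action (R : realType) (G : groupType)
    (act : G -> R -> R) : Prop :=
  is_continuous_action act /\ (forall g, {homo act g : x y / x < y}).

Definition nontrivial_action (G : groupType) (X : Type) (act : G -> X -> X) :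
    Prop :=
  exists g, act g <> id.

Definition has_infinite_cyclic_quotient (G : groupType) : Prop :=
  exists f : G -> int,
    {morph f : x y / (x * y)%g >-> x + y} /\ range f = [set: int].

(* Main.v *)
Require Import Defs.
From HB Require Import structures.
From mathcomp Require Import all_boot all_order all_algebra.
From mathcomp Require Import all_classical all_reals all_analysis.
From mathcomp Require Import zify ring lra.

(** A homomorphism onto the integers makes the group act by translations; the
    content is the converse, due to Witte Morris.

    The points of the line where an action is not trivial give left-invariant
    total preorders on the group [G]: compare [g x] and [h x].  Such a preorder
    is recorded by its cone [C], the set of the elements [>= 1], which is closed
    under products and contains [x] or [x^-1] for every [x].  Preorders are used
    instead of orders so that the kernel of the action need not be divided out.
    When [G] is finitely generated, a cone is proper if and only if it misses
    one of finitely many generators, so the proper cones form a compact space,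
    on which [G] acts by conjugation.  Amenability gives an invariant
    probability measure on it.  By Poincare recurrence ([poincare_recurrence])
    almost every cone [C] is recurrent: if [a > 1] then also
    [b^-n a b^n > 1] for some [n > 0], that is [a b^n > b^n]
    ([exists_recurrent_cone]).

    A recurrent cone has no crossings ([no_crossing]): when [s > 1], the set of
    the elements lying between two powers of [s] is a subgroup
    ([convex_hullM], [convex_hullV]).  Taking for [s] the largest of the
    generators, this subgroup is [G].  Elements whose powers are cofinal in [G]
    are stable under conjugation ([cofinal_conj]), and the elements [g] for
    which neither [g] nor [g^-1] is cofinal form the largest proper convex
    subgroup; it is normal, and the preorder induced on the quotient is
    bi-invariant and Archimedean ([exists_biinvariant_cone]).  Hoelder's
    argument ([holder]) then gives a nonzero homomorphism from [G] to the
    reals, and since [G] is finitely generated its values can be replaced by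
    integers satisfying the same linear relations ([integer_functional]). *)

Set Implicit Arguments.
Unset Strict Implicit.
Unset Printing Implicit Defensive.

Import Order.TTheory GRing.Theory Num.Theory.
Import numFieldNormedType.Exports.

Local Open Scope classical_set_scope.
Local Open Scope group_scope.

(** * Generating sequences *)

Definition generates (G : groupType) (S : seq G) : Prop :=
  forall x, exists2 w : seq nat,
    all (ltn^~ (size S)) w & x = \prod_(i <- w) nth 1 S i.

Lemma generates_ind (G : groupType) (S : seq G) (P : G -> Prop) :
  generates S -> P 1 -> (forall x y, x \in S -> P y -> P (x * y)) ->
  forall x, P x.
Proof.
move=> Sgen P1 PM x; have [w wS ->] := Sgen x.
elim: w wS => [|i w IHw] /=; first by rewrite big_nil.
by move=> /andP[iS /IHw Pw]; rewrite big_cons; apply: PM; rewrite ?mem_nth.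
Qed.

(** With the inverses added to the generators, every element is a product of
    generators, and no negative powers have to be handled. *)
Lemma exists_generating_seq (G : groupType) : finitely_generated G ->
  exists2 S : seq G, (forall x, x \in S -> x^-1 \in S) & generates S.
Proof.
move=> [A /finite_seqP[s ->] sgen]; pose S := s ++ [seq x^-1 | x <- s].
have SV x : x \in S -> x^-1 \in S.
  rewrite !mem_cat => /orP[xs|/mapP[y ys ->]]; last by rewrite invgK ys.
  by rewrite map_f ?orbT.
exists S => //.
pose word x := exists2 w : seq nat,
  all (ltn^~ (size S)) w & x = \prod_(i <- w) nth 1 S i.
have wordS x : x \in S -> word x.
  move=> xS; exists [:: index x S]; first by rewrite /= index_mem xS.
  by rewrite big_seq1 nth_index.
have wordM x y : word x -> word y -> word (x * y).
  move=> [v vS ->] [w wS ->]; exists (v ++ w); first by rewrite all_cat vS.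
  by rewrite big_cat.
suff sub : subgroup_generated [set` s] `<=` [set x | word x /\ word x^-1].
  by move=> x; have /sub[] : subgroup_generated [set` s] x by rewrite sgen.
apply: smallest_sub => [|x /= xs].
  split=> [|x y]; rewrite !inE.
    by rewrite /= invg1; split; exists [::]; rewrite ?big_nil.
  by move=> [Wx WVx] [Wy WVy]; split; rewrite ?invgM ?invgK; exact: wordM.
have xS : x \in S by rewrite mem_cat xs.
by split; apply: wordS; rewrite ?SV.
Qed.

(** * Left-invariant total preorders *)

(** The set of elements [>= 1] of a left-invariant total preorder. *)
Definition cone (G : groupType) (C : G -> bool) : Prop :=
  (forall x y, C x -> C y -> C (x * y)) /\ (forall x, C x || C x^-1).

Definition cone_le (G : groupType) (C : G -> bool) (x y : G) := C (x^-1 * y).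

Definition dual_cone (G : groupType) (C : G -> bool) (x : G) := C x^-1.

(** As [~~ C a] means [a < 1], this says that every strict inequality
    [a < 1] comes back, as [a * b ^+ n < b ^+ n], along the powers of any
    [b]. *)
Definition recurrent (G : groupType) (C : G -> bool) : Prop :=
  forall a b, ~~ C a -> exists2 n, (0 < n)%N & ~~ C (a ^ (b ^+ n)).

Lemma dual_cone_cone (G : groupType) (C : G -> bool) :
  cone C -> cone (dual_cone C).
Proof.
move=> [CM Ct]; split=> [x y Cx Cy|x]; last exact: Ct.
by rewrite /dual_cone invgM; exact: CM.
Qed.

Lemma dual_cone_le (G : groupType) (C : G -> bool) x y :
  cone_le (dual_cone C) x y = cone_le C y x.
Proof. by rewrite /cone_le /dual_cone invgM invgK. Qed.

Lemma dual_cone_recurrent (G : groupType) (C : G -> bool) :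
  recurrent C -> recurrent (dual_cone C).
Proof.
move=> Cr a b Ca; have [n n_gt0 Cn] := Cr a^-1 b Ca.
by exists n; rewrite // /dual_cone -conjVg.
Qed.

Section ConeOrder.
Variables (G : groupType) (C : G -> bool).
Hypothesis coneC : cone C.
Implicit Types (x y z : G) (m n : nat).
Local Notation le := (cone_le C).

Lemma cone_total x : C x || C x^-1.
Proof. exact: coneC.2. Qed.

Lemma cone1 : C 1.
Proof. by have := cone_total 1; rewrite invg1 orbb. Qed.

Lemma cone_lexx x : le x x.
Proof. by rewrite /cone_le mulVg cone1. Qed.

Lemma cone_le_trans y x z : le x y -> le y z -> le x z.
Proof.
by move=> lexy leyz; have := coneC.1 _ _ lexy leyz; rewrite -mulgA mulVKg.
Qed.

Lemma cone_le_total x y : le x y || le y x.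
Proof. by have := cone_total (x^-1 * y); rewrite /cone_le invgM invgK. Qed.

Lemma cone_leNgt x y : ~~ le x y -> le y x.
Proof. by have /orP[->|] := cone_le_total x y. Qed.

Lemma cone_le_mul2l z x y : le (z * x) (z * y) = le x y.
Proof. by rewrite /cone_le invgM -mulgA mulKg. Qed.

Lemma cone_le1l x : le 1 x = C x.
Proof. by rewrite /cone_le invg1 mul1g. Qed.

Lemma cone_le1r x : le x 1 = C x^-1.
Proof. by rewrite /cone_le mulg1. Qed.

Lemma cone_expg x n : C x -> C (x ^+ n).
Proof.
by move=> Cx; elim: n => [|n IHn]; [exact: cone1|rewrite expgS; exact: coneC.1].
Qed.

Lemma cone_le_expg2l x m n : C x -> (m <= n)%N -> le (x ^+ m) (x ^+ n).
Proof.
move=> Cx /subnKC <-; rewrite expgnDr -{1}[x ^+ m]mulg1 cone_le_mul2l cone_le1l.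
exact: cone_expg.
Qed.

Lemma cone_ltW x : ~~ C x^-1 -> C x.
Proof. by have /orP[->|->] := cone_total x. Qed.

Lemma exists_cone_max (t : G) (s : seq G) : t \in s ->
  exists2 u, u \in s & forall v, v \in s -> le v u.
Proof.
elim: s t => // a [|b s] IHs t _.
  by exists a => [|v]; rewrite inE // => /eqP->; exact: cone_lexx.
have [u us umax] := IHs b (mem_head _ _).
have /orP[leau|leua] := cone_le_total a u.
  by exists u => [|v]; rewrite inE ?us ?orbT // => /predU1P[->//|/umax].
exists a => [|v]; rewrite inE ?eqxx // => /predU1P[->|/umax levu].
  exact: cone_lexx.
exact: cone_le_trans leua.
Qed.

(** * Recurrent preorders have no crossings *)

Section Recurrent.
Hypothesis recC : recurrent C.

(** If [u >= 1] but [u] keeps all the powers of [s] below [s ^+ m], then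
    [a = s * u * s ^+ m.+1] is [> 1], while [a * s ^+ j <= s ^+ m.+1] for every
    [j]; so [a * s ^+ j > s ^+ j] fails as soon as [j >= m.+1], and [a] does
    not recur along the powers of [s ^+ m.+1]. *)
Lemma no_crossing s u m : ~~ C s^-1 -> C u ->
  ~ (forall N, le (u * s ^+ N) (s ^+ m)).
Proof.
move=> s_gt1 Cu ubound; have Cs := cone_ltW s_gt1.
have a_gt1 : ~~ C (s * (u * s ^+ m.+1))^-1.
  apply: contra s_gt1; rewrite -!cone_le1r; apply: cone_le_trans.
  rewrite -{1}[s]mulg1 cone_le_mul2l cone_le1l; apply: coneC.1 => //.
  exact: cone_expg.
have [n n_gt0 /negP[]] := recC (s ^+ m.+1) a_gt1.
rewrite -expgnA conjgE mulgA -invgM -/(cone_le C _ _).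
rewrite -!mulgA -expgnDr; apply: (@cone_le_trans (s ^+ m.+1)).
  by rewrite [s ^+ m.+1]expgS cone_le_mul2l.
by apply: cone_le_expg2l => //; rewrite leq_pmulr.
Qed.

(** Say [g <= s ^+ n] and [h <= s ^+ m].  If [g * s ^+ m] exceeded every power
    of [s], then [g^-1 * s ^+ n >= 1] would keep the powers of [s] below
    [s ^+ m]. *)
Lemma bounded_above_mul s g h : ~~ C s^-1 ->
  (exists n, le g (s ^+ n)) -> (exists n, le h (s ^+ n)) ->
  exists n, le (g * h) (s ^+ n).
Proof.
move=> s_gt1 [n legn] [m lehm].
have [[N leN]|nleN] := pselect (exists N, le (g * s ^+ m) (s ^+ N)).
  by exists N; apply: cone_le_trans leN; rewrite cone_le_mul2l.
case: (@no_crossing s (g^-1 * s ^+ n) m) => // N.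
rewrite -mulgA -expgnDr -(cone_le_mul2l g) mulVKg; apply: cone_leNgt.
by apply/negP => leN; apply: nleN; exists (n + N)%N.
Qed.

(** If [g^-1] exceeded every power of [s], then [g * s ^+ N <= 1] for all [N],
    and [s ^+ n * g >= 1] would keep the powers of [s] below [s ^+ n]. *)
Lemma bounded_above_inv s g : ~~ C s^-1 ->
  (exists n, le (s ^- n) g) -> exists n, le g^-1 (s ^+ n).
Proof.
move=> s_gt1 [n legn]; apply: contrapT => nle.
case: (@no_crossing s (s ^+ n * g) n) => //.
  by move: legn; rewrite /cone_le invgK.
move=> N; rewrite -[X in le _ X]mulg1 -mulgA cone_le_mul2l.
rewrite -(cone_le_mul2l g^-1) mulKg mulg1; apply: cone_leNgt.
by apply/negP => leN; apply: nle; exists N.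
Qed.

End Recurrent.
End ConeOrder.

Definition convex_hull (G : groupType) (C : G -> bool) (s g : G) : Prop :=
  (exists n, cone_le C (s ^- n) g) /\ (exists n, cone_le C g (s ^+ n)).

Definition cofinal (G : groupType) (C : G -> bool) (x : G) : Prop :=
  ~~ C x^-1 /\ (forall z, convex_hull C x z).

Section ConvexHull.
Variables (G : groupType) (C : G -> bool).
Hypothesis coneC : cone C.
Hypothesis recC : recurrent C.
Implicit Types (g h s x y z : G).
Local Notation le := (cone_le C).

(** Exchanges the two halves of [convex_hull], so that the lower bounds in the
    next lemmas follow from the upper bounds for the dual cone, which is
    recurrent too. *)
Lemma dual_convex_hull s g :
  convex_hull (dual_cone C) s^-1 g <-> convex_hull C s g.
Proof.
by split=> -[[n nP] [m mP]]; split; [exists m|exists n|exists m|exists n];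
  move: nP mP; rewrite ?expVgn ?invgK !dual_cone_le.
Qed.

Lemma convex_hull1 s : convex_hull C s 1.
Proof. by split; exists 0%N; rewrite expg0 ?invg1; exact: cone_lexx. Qed.

Lemma convex_hullM s g h : ~~ C s^-1 ->
  convex_hull C s g -> convex_hull C s h -> convex_hull C s (g * h).
Proof.
move=> s_gt1 gB hB; split; last exact: bounded_above_mul gB.2 hB.2.
have s'_gt1 : ~~ dual_cone C s^-1^-1 by rewrite /dual_cone invgK.
move/dual_convex_hull: gB => gB; move/dual_convex_hull: hB => hB.
have [n] := bounded_above_mul (dual_cone_cone coneC) (dual_cone_recurrent recC)
  s'_gt1 gB.2 hB.2.
by rewrite dual_cone_le expVgn => nP; exists n.
Qed.

Lemma convex_hullV s g : ~~ C s^-1 ->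
  convex_hull C s g -> convex_hull C s g^-1.
Proof.
move=> s_gt1 gB; split; last exact: bounded_above_inv gB.1.
have s'_gt1 : ~~ dual_cone C s^-1^-1 by rewrite /dual_cone invgK.
move/dual_convex_hull: gB => gB.
have [n] := bounded_above_inv (dual_cone_cone coneC) (dual_cone_recurrent recC)
  s'_gt1 gB.1.
by rewrite dual_cone_le expVgn => nP; exists n.
Qed.

Lemma convex_hull_convex s x y z : convex_hull C s x -> convex_hull C s z ->
  le x y -> le y z -> convex_hull C s y.
Proof.
move=> [[n nP] _] [_ [m mP]] lexy leyz.
by split; [exists n; exact: cone_le_trans lexy
          |exists m; exact: cone_le_trans mP].
Qed.

Lemma convex_hull_between s x : C x -> le x s -> convex_hull C s x.
Proof.
by move=> Cx lexs; split; [exists 0%N|exists 1%N]; rewrite // invg1 cone_le1l.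
Qed.

Lemma convex_hullX s g n : ~~ C s^-1 ->
  convex_hull C s g -> convex_hull C s (g ^+ n).
Proof.
move=> s_gt1 gB; elim: n => [|n IHn]; first exact: convex_hull1.
by rewrite expgS; exact: convex_hullM.
Qed.

Lemma convex_hull_trans s x g : ~~ C s^-1 ->
  convex_hull C s x -> convex_hull C x g -> convex_hull C s g.
Proof.
move=> s_gt1 xB [[n nP] [m mP]]; apply: convex_hull_convex nP mP.
  by apply: convex_hullV => //; exact: convex_hullX.
exact: convex_hullX.
Qed.

(** The hull of the largest generator is a subgroup containing all the
    generators. *)
Lemma exists_cofinal (S : seq G) :
  (forall x, x \in S -> x^-1 \in S) -> generates S ->
  (exists2 x, x \in S & ~~ C x) -> exists s, cofinal C s.
Proof.
move=> SV Sgen [t tS t_lt1].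
have [s sS smax] := exists_cone_max coneC (SV _ tS).
have s_gt1 : ~~ C s^-1.
  apply: contra t_lt1; rewrite -cone_le1r => les1.
  have := cone_le_trans coneC (smax _ (SV _ tS)) les1.
  by rewrite cone_le1r invgK.
have pos x : x \in S -> C x -> convex_hull C s x.
  by move=> xS Cx; apply: convex_hull_between => //; exact: smax.
exists s; split=> //.
apply: (generates_ind Sgen) => [|x g xS gB]; first exact: convex_hull1.
apply: convex_hullM gB => //; have /orP[Cx|Cx] := cone_total coneC x.
  exact: pos.
by rewrite -[x]invgK; apply: convex_hullV => //; apply: pos => //; exact: SV.
Qed.

(** * The bi-invariant Archimedean preorder *)

Lemma cofinal_hull x y : ~~ C y^-1 -> cofinal C x -> convex_hull C y x ->
  cofinal C y.
Proof.
by move=> y_gt1 [_ xall] xB; split=> // z; exact: convex_hull_trans (xall z).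
Qed.

Lemma cofinal_le x y : cofinal C x -> le x y -> cofinal C y.
Proof.
move=> cofx lexy.
have y_gt1 : ~~ C y^-1.
  by apply: contra cofx.1; rewrite -!cone_le1r; exact: cone_le_trans.
apply: (cofinal_hull y_gt1 cofx); apply: convex_hull_between => //.
exact: cone_ltW cofx.1.
Qed.

(** If the conjugate [w = x ^ y] is not cofinal then [w ^+ n <= x] for every
    [n], since otherwise the hull of [w] would contain [x].  This reads
    [x ^+ n * y <= y * x], which is impossible: [y >= x ^- k] and
    [y * x <= x ^+ m] for some [k] and [m], so [x ^+ (n - k) <= x ^+ m] for
    every [n >= k]. *)
Lemma cofinal_conj x y : cofinal C x -> cofinal C (x ^ y).
Proof.
move=> cofx; apply: contrapT => ncof.
have Cx := cone_ltW coneC cofx.1.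
have small n : le ((x ^ y) ^+ n) x.
  have [w_le1|w_gt1] := boolP (C (x ^ y)^-1).
    apply: (@cone_le_trans _ _ coneC 1); last by rewrite cone_le1l.
    by rewrite cone_le1r -expVgn; exact: cone_expg.
  apply: (cone_leNgt coneC); apply/negP => lexw.
  apply/ncof/(cofinal_hull w_gt1 cofx); split; last by exists n.
  by exists 0%N; rewrite expg0 invg1 cone_le1l.
have [[k yk] _] := cofx.2 y; have [_ [m ym]] := cofx.2 (y * x).
have /negP[] := cofx.1.
rewrite -cone_le1r -(cone_le_mul2l C (x ^+ m)) mulg1 -expgSr.
apply: cone_le_trans ym => //.
have := small (m.+1 + k)%N.
rewrite -conjXg conjgE -(cone_le_mul2l C y) mulVKg.
apply: cone_le_trans => //.
by rewrite -{1}(mulgK (x ^+ k) (x ^+ m.+1)) -expgnDr cone_le_mul2l.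
Qed.

(** When both are [> 1], the larger has the product in its hull.  The conjugate
    [y * x] of [x * y] takes the place of right invariance. *)
Lemma cofinalM x y : cofinal C (x * y) -> cofinal C x \/ cofinal C y.
Proof.
move=> cofxy.
have cofyx : cofinal C (y * x).
  by rewrite -[y * x](mulKg x) (mulgA x) -conjgE; exact: cofinal_conj.
have [y_le1|y_gt1] := boolP (C y^-1).
  left; apply: cofinal_le cofxy _.
  by rewrite -[X in le _ X]mulg1 cone_le_mul2l cone_le1r.
have [x_le1|x_gt1] := boolP (C x^-1).
  right; apply: cofinal_le cofyx _.
  by rewrite -[X in le _ X]mulg1 cone_le_mul2l cone_le1r.
have [Cx Cy] := (cone_ltW coneC x_gt1, cone_ltW coneC y_gt1).
have /orP[lexy|leyx] := cone_le_total coneC x y.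
  right; apply: (cofinal_hull y_gt1 cofxy).
  by apply: convex_hullM => //; apply: convex_hull_between => //;
    exact: cone_lexx.
left; apply: (cofinal_hull x_gt1 cofxy).
by apply: convex_hullM => //; apply: convex_hull_between => //;
  exact: cone_lexx.
Qed.

Lemma cofinal_asym x : cofinal C x -> ~ cofinal C x^-1.
Proof. by move=> [/(cone_ltW coneC) Cx _] [/negP[]]; rewrite invgK. Qed.

(** The cone [D] is the preorder of [C] coarsened modulo the largest proper
    convex subgroup: [x] is negative for [D] when [x^-1] is cofinal. *)
Lemma exists_biinvariant_cone s : cofinal C s ->
  exists D : G -> bool,
    [/\ cone D, (forall x y, D x -> D (x ^ y)) & cofinal D s].
Proof.
move=> cofs; pose D x := ~~ `[< cofinal C x^-1 >].
have CD x : C x -> D x.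
  by move=> Cx; apply/asboolPn => -[/negP[]]; rewrite invgK.
exists D; split; first split.
- move=> x y /asboolPn Dx /asboolPn Dy; apply/asboolPn.
  by rewrite invgM => /cofinalM[/Dy|/Dx].
- by move=> x; rewrite -negb_and; apply/negP => /andP[/asboolP + /asboolP];
    exact: cofinal_asym.
- move=> x y /asboolPn Dx; apply/asboolPn; rewrite -conjVg => cof; apply: Dx.
  by rewrite -[x^-1](conjgK y); exact: cofinal_conj.
split=> [|g].
  by rewrite negbK invgK; exact/asboolP.
have [[n nP] [m mP]] := cofs.2 g.
by split; [exists n|exists m]; exact: CD.
Qed.

End ConvexHull.

(** * Hoelder's theorem *)

Definition intexp (G : groupType) (x : G) (n : int) : G :=
  match n with Posz m => x ^+ m | Negz m => x ^- m.+1 end.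

Lemma intexpB (G : groupType) (x : G) (m n : nat) :
  intexp x (m%:Z - n%:Z)%R = x ^+ m * x ^- n.
Proof.
have [le_nm|lt_mn] := leqP n m; first by rewrite subzn // -expgnFr.
rewrite -(subnKC lt_mn) addSnnS [in RHS]addnC expgnDr invgM mulVKg.
by rewrite PoszD opprD addNKr -NegzE.
Qed.

Lemma intexpD (G : groupType) (x : G) (m n : int) :
  intexp x (m + n)%R = intexp x m * intexp x n.
Proof.
have int_sub (k : int) : exists p : nat * nat, k = (p.1%:Z - p.2%:Z)%R.
  case: k => k; first by exists (k, 0)%N; rewrite subr0.
  by exists (0, k.+1)%N; rewrite NegzE sub0r.
have [[a b] ->] := int_sub m; have [[c d] ->] := int_sub n => /=.
rewrite addrACA -opprD -!PoszD !intexpB expgnDr [(b + d)%N]addnC expgnDr invgM.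
rewrite -!mulgA; congr (_ * _); rewrite !mulgA; congr (_ * _).
exact/commuteV/commuteX2.
Qed.

Section BiInvariant.
Variables (G : groupType) (D : G -> bool).
Hypothesis coneD : cone D.
Hypothesis conjD : forall x y, D x -> D (x ^ y).
Implicit Types (x y z g h : G).
Local Notation le := (cone_le D).

Lemma biinvariant_leM x y z t : le x y -> le z t -> le (x * z) (y * t).
Proof.
move=> lexy lezt; apply: (@cone_le_trans _ _ coneD (y * z)); last first.
  by rewrite cone_le_mul2l.
by rewrite /cone_le invgM -mulgA (mulgA x^-1) -conjgE; exact: conjD.
Qed.

Lemma biinvariant_commuteX g h k : le (h * g) (g * h) ->
  le (h ^+ k * g) (g * h ^+ k).
Proof.
move=> le_hg; elim: k => [|k IHk]; first by rewrite mulg1 mul1g cone_lexx.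
rewrite {1}expgSr -mulgA; apply: (@cone_le_trans _ _ coneD (h ^+ k * (g * h))).
  by rewrite cone_le_mul2l.
by rewrite expgSr !mulgA; apply: biinvariant_leM => //; exact: cone_lexx.
Qed.

(** Sorting the letters of [(g * h) ^+ k] moves the product in one direction
    only, and this stands in for the commutativity of the group. *)
Lemma biinvariant_expgM g h k : le (h * g) (g * h) ->
  le ((g * h) ^+ k) (g ^+ k * h ^+ k) /\ le (h ^+ k * g ^+ k) ((g * h) ^+ k).
Proof.
move=> le_hg; elim: k => [|k [IHl IHr]].
  by rewrite mulg1 cone_lexx.
split.
  rewrite expgSr (expgSr g) (expgSr h).
  apply: (@cone_le_trans _ _ coneD (g ^+ k * h ^+ k * (g * h))).
    by apply: biinvariant_leM => //; exact: cone_lexx.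
  rewrite -!mulgA cone_le_mul2l !mulgA; apply: biinvariant_leM.
    exact: biinvariant_commuteX.
  exact: cone_lexx.
rewrite [(g * h) ^+ k.+1]expgS [g ^+ k.+1]expgS.
apply: (@cone_le_trans _ _ coneD (g * h * (h ^+ k * g ^+ k))); last first.
  by rewrite cone_le_mul2l.
rewrite mulgA -(mulgA g h) (mulgA h) -expgS mulgA; apply: biinvariant_leM.
  exact: biinvariant_commuteX.
exact: cone_lexx.
Qed.

End BiInvariant.

Local Open Scope ring_scope.

Section Floor.
Variables (G : groupType) (D : G -> bool) (s : G).
Hypothesis coneD : cone D.
Hypothesis cofs : cofinal D s.
Local Notation le := (cone_le D).

Lemma intexp_cone (n : int) : D (intexp s n) = (0 <= n).
Proof.
have Ds := cone_ltW coneD cofs.1; case: n => n; first exact: cone_expg.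
apply: negbTE; apply/negP => Dsn; have /negP[] := cofs.1.
have := coneD.1 _ _ Dsn (cone_expg coneD n Ds).
by rewrite /intexp expgSr invgM -mulgA mulVg mulg1.
Qed.

Lemma intexp_le (m n : int) : le (intexp s m) (intexp s n) = (m <= n).
Proof.
rewrite -subr_ge0 -intexp_cone /cone_le; congr (D _).
by apply: (mulgI (intexp s m)); rewrite mulVKg -intexpD addrCA subrr addr0.
Qed.

Lemma exists_floor g :
  exists n : int, forall m : int, le (intexp s m) g = (m <= n).
Proof.
have [[a aP] [b bP]] := cofs.2 g.
have leNa : le (intexp s (- a%:Z)) g.
  have -> // : intexp s (- a%:Z) = (s ^- a)%g.
  by rewrite -[- _]add0r (intexpB s 0 a) mul1g.
have leb : le g (intexp s b) by [].
suff [n le_n gt_n] : exists2 n : int,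
    le (intexp s n) g & ~~ le (intexp s (n + 1)) g.
  exists n => m; apply/idP/idP => [le_m|le_mn].
    rewrite leNgt -lezD1; apply: contra gt_n => lt_nm.
    by apply: cone_le_trans le_m => //; rewrite intexp_le.
  by apply: cone_le_trans le_n => //; rewrite intexp_le.
(* The candidates are shifted by [a] in order to search among naturals. *)
have exk : exists k : nat, ~~ le (intexp s (k%:Z - a%:Z + 1)) g.
  exists (a + b)%N; apply/negP => lek; have := cone_le_trans coneD lek leb.
  by rewrite intexp_le; lia.
case: (ex_minnP exk) => -[|k] kP kmin.
  by exists (0%:Z - a%:Z); rewrite ?sub0r // -[- _]sub0r.
exists (k.+1%:Z - a%:Z) => //; apply/negPn/negP => nle.
have := kmin k; rewrite ltnn => /(_ _)/notF; apply.
by apply: contra nle; rewrite intS addrC addrA.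
Qed.

End Floor.

Lemma le0_of_mulrn_bounded (R : archiRealFieldType) (x c : R) :
  (forall k : nat, k%:R * x <= c) -> x <= 0.
Proof.
move=> bound; rewrite leNgt; apply/negP => x_gt0.
have := archi_boundP (normr_ge0 (c / x)).
set k := Num.bound _ => /(le_lt_trans (ler_norm _)).
by rewrite ltr_pdivrMr // ltNge bound.
Qed.

(** The slope is the supremum of the quotients [a k / k]: comparing [a] at the
    common multiple [j * k] gives [a j / j <= (a k + 1) / k] for all positive
    [j] and [k]. *)
Lemma almost_additive_slope (R : realType) (a : nat -> int) :
  (forall m n, a m + a n <= a (m + n)%N) ->
  (forall m n, a (m + n)%N <= a m + a n + 1) ->
  exists r : R, forall k, (a k)%:~R <= k%:R * r <= (a k)%:~R + 1.
Proof.
move=> a_super a_sub.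
have a0_le : a 0%N <= 0 by have := a_super 0%N 0%N; rewrite addn0; lia.
have a0_ge : 0 <= a 0%N + 1 by have := a_sub 0%N 0%N; rewrite addn0; lia.
have mul_lower j k : j.+1%:Z * a k <= a (j.+1 * k)%N.
  elim: j => [|j IHj]; first by rewrite mul1n; lia.
  rewrite intS mulrDl mul1r.
  by have := a_super k (j.+1 * k)%N; rewrite -mulSn; lia.
have mul_upper j k : a (j.+1 * k)%N + 1 <= j.+1%:Z * (a k + 1).
  elim: j => [|j IHj]; first by rewrite mul1n; lia.
  rewrite intS mulrDl mul1r.
  by have := a_sub k (j.+1 * k)%N; rewrite -mulSn; lia.
pose slope k : R := (a k.+1)%:~R / k.+1%:R.
have slope_le j k : slope j <= ((a k.+1)%:~R + 1) / k.+1%:R.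
  rewrite ler_pdivrMr // mulrAC ler_pdivlMr //.
  have : k.+1%:Z * a j.+1 <= j.+1%:Z * (a k.+1 + 1).
    have := mul_lower k j.+1; have := mul_upper j k.+1.
    by rewrite mulnC; lia.
  by rewrite -(ler_int R) !intrM intrD mulrC [X in _ <= X]mulrC.
have sup_slope : has_sup (range slope).
  split; first by exists (slope 0%N), 0%N.
  by exists (((a 1%N)%:~R + 1) / 1%:R) => _ [j _ <-]; exact: (slope_le j 0%N).
exists (sup (range slope)) => -[|k].
  by rewrite mul0r -[1]/1%:~R -intrD !ler0z lerz0 a0_le.
rewrite mulrC -ler_pdivrMr // -[X in _ && X]ler_pdivlMr //.
apply/andP; split; first by apply: sup_upper_bound => //; exists k.
by apply: ge_sup => [|_ [j _ <-]]; [exists (slope 0%N), 0%N|].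
Qed.

(** With [fl g] the exponent of the largest power of [s] below [g], [phi g] is
    the slope of [k |-> fl (g ^+ k)].  The map [fl] is additive up to [1], and
    [fl ((g * h) ^+ k)] differs from [fl (g ^+ k) + fl (h ^+ k)] by at most
    [1], for every [k]; dividing by [k] makes the error vanish. *)
Lemma holder (R : realType) (G : groupType) (D : G -> bool) (s : G) :
  cone D -> (forall x y, D x -> D (x ^ y)%g) -> cofinal D s ->
  exists phi : G -> R, {morph phi : x y / (x * y)%g >-> x + y} /\ phi s <> 0.
Proof.
move=> coneD conjD cofs.
have [fl flP] := choice (exists_floor coneD cofs).
have fl_le g h : cone_le D g h -> fl g <= fl h.
  by move=> le_gh; rewrite -flP; apply: cone_le_trans le_gh; rewrite // flP.
have fl_super g h : fl g + fl h <= fl (g * h)%g.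
  by rewrite -flP intexpD; apply: biinvariant_leM; rewrite // flP.
have fl_lt g : cone_le D g (intexp s (fl g + 1)).
  by apply: cone_leNgt => //; rewrite flP gerDl.
have fl_sub g h : fl (g * h)%g <= fl g + fl h + 1.
  suff: ~~ cone_le D (intexp s (fl g + fl h + 2)) (g * h)%g by rewrite flP; lia.
  apply/negP => le_gh.
  have: cone_le D (intexp s (fl h + 1)) h; last by rewrite flP; lia.
  rewrite -(cone_le_mul2l _ (intexp s (fl g + 1))) -intexpD.
  have -> : fl g + 1 + (fl h + 1) = fl g + fl h + 2 by lia.
  apply: cone_le_trans le_gh _ => //.
  by apply: biinvariant_leM => //; exact: cone_lexx.
have slope g : exists r : R, forall k,
    (fl (g ^+ k)%g)%:~R <= k%:R * r <= (fl (g ^+ k)%g)%:~R + 1.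
  by apply: almost_additive_slope => m n; rewrite expgnDr.
have [phi phiP] := choice slope.
have fl_pow g h k : fl (g ^+ k)%g + fl (h ^+ k)%g <= fl ((g * h) ^+ k)%g
    <= fl (g ^+ k)%g + fl (h ^+ k)%g + 1.
  have /orP[le_hg|le_gh] := cone_le_total coneD (h * g)%g (g * h)%g.
    have [le1 le2] := biinvariant_expgM coneD conjD k le_hg.
    apply/andP; split; last exact: le_trans (fl_le _ _ le1) (fl_sub _ _).
    by rewrite addrC; apply: le_trans (fl_super _ _) (fl_le _ _ le2).
  have [||le1 le2] :=
    @biinvariant_expgM _ (dual_cone D) (dual_cone_cone coneD) _ g h k.
  - by move=> x y; rewrite /dual_cone -conjVg; exact: conjD.
  - by rewrite dual_cone_le.
  move: le1 le2; rewrite !dual_cone_le => /fl_le le1 /fl_le le2.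
  apply/andP; split; first exact: le_trans (fl_super _ _) le1.
  by rewrite [X in _ <= X + 1]addrC; apply: le_trans le2 (fl_sub _ _).
exists phi; split=> [g h|]; last first.
  move=> phis0; have /andP[+ _] := phiP s 1%N.
  have -> : fl (s ^+ 1)%g = 1; last by rewrite phis0 mulr0 ler10.
  apply/le_anti/andP; split; last by rewrite -flP cone_lexx.
  by rewrite -(intexp_le coneD cofs) flP.
apply/eqP; rewrite -subr_eq0; apply/eqP/le_anti/andP; split.
  apply: (@le0_of_mulrn_bounded _ _ 2) => k.
  have := phiP g k; have := phiP h k; have := phiP (g * h)%g k.
  have := fl_pow g h k; rewrite -2!(ler_int R) !intrD; lra.
rewrite -oppr_le0; apply: (@le0_of_mulrn_bounded _ _ 2) => k.
have := phiP g k; have := phiP h k; have := phiP (g * h)%g k.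
have := fl_pow g h k; rewrite -2!(ler_int R) !intrD; lra.
Qed.

(** * From real values to integer values *)

(** By induction on [k].  If [r k] occurs in an integer relation [q], then the
    functional [c] found for the first [k] values, multiplied by [q k], extends
    to the last one, with the value forced by [q]; otherwise the last
    coordinate itself kills all the relations. *)
Lemma integer_functional (R : numDomainType) (k : nat) (r : nat -> R) :
  (exists2 i, (i < k)%N & r i != 0) ->
  exists c : nat -> int, (exists2 i, (i < k)%N & c i != 0) /\
    forall v : nat -> int,
      \sum_(i < k) (v i)%:~R * r i = 0 -> \sum_(i < k) v i * c i = 0.
Proof.
elim: k => [|k IHk] r_neq0; first by case: r_neq0.
have [[q qk_neq0 qr0]|indep] := pselect (exists2 q : nat -> int,
    q k != 0 & \sum_(i < k.+1) (q i)%:~R * r i = 0); last first.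
  exists (fun i => (i == k)%:R); split=> [|v vr0].
    by exists k; rewrite // eqxx.
  rewrite big_ord_recr /= eqxx mulr1 big1 => [|i _]; last first.
    by rewrite ltn_eqF ?mulr0.
  by rewrite add0r; apply/eqP/negPn/negP => vk; apply: indep; exists v.
have [|c [[j lt_jk cj] cP]] := IHk.
  apply: contrapT => nr; case: r_neq0 => i; rewrite ltnS leq_eqVlt.
  have r0 j : (j < k)%N -> r j = 0.
    by move=> lt_jk; apply/eqP/negPn/negP => rj; apply: nr; exists j.
  move=> /predU1P[->|/r0->]; last by rewrite eqxx.
  move: qr0; rewrite big_ord_recr /= big1 => [|j _]; last by rewrite r0 ?mulr0.
  by move/eqP; rewrite add0r mulf_eq0 intr_eq0 (negbTE qk_neq0) => /= ->.
exists (fun i => if (i < k)%N then q k * c i else - \sum_(j < k) q j * c j).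
split=> [|v vr0].
  by exists j; rewrite ?lt_jk ?mulf_neq0 //; exact: ltnW.
(* This combination of the relations [v] and [q] does not involve [r k]. *)
have := cP (fun i => q k * v i - v k * q i).
rewrite big_ord_recr /= ltnn.
under [X in _ -> X + _ = _]eq_bigr => i _ do rewrite ltn_ord.
move=> cq0; rewrite -[RHS]cq0; last first.
  move: qr0 vr0; rewrite !big_ord_recr /= => /(canRL (addrK _)) qr0.
  move=> /(canRL (addrK _)) vr0.
  under eq_bigr => i _ do rewrite rmorphB !rmorphM /= mulrBl -!mulrA.
  by rewrite sumrB -!mulr_sumr qr0 vr0; ring.
rewrite mulrN mulr_sumr -sumrB; apply: eq_bigr => i _; ring.
Qed.

Lemma big_count (V : zmodType) (k : nat) (w : seq nat) (F : nat -> V) :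
  all (ltn^~ k) w ->
  \sum_(i <- w) F i = \sum_(i < k) F i *+ count_mem (i : nat) w.
Proof.
elim: w => [|j w IHw] /=; first by rewrite big_nil big1.
move=> /andP[lt_jk /IHw wE]; rewrite big_cons wE.
under [RHS]eq_bigr => i _ do rewrite mulrnDr.
rewrite big_split /=; congr (_ + _).
rewrite (bigD1 (Ordinal lt_jk)) //= eqxx mulr1n big1 ?addr0 // => i.
by rewrite -val_eqE /= eq_sym => /negbTE->.
Qed.

Section IntegerQuotient.
Variable G : groupType.

Lemma hom1 (V : zmodType) (f : G -> V) :
  {morph f : x y / (x * y)%g >-> x + y} -> f 1%g = 0.
Proof. by move=> fM; apply: (addIr (f 1%g)); rewrite -fM mulg1 add0r. Qed.

Lemma hom_prod (V : zmodType) (f : G -> V) (I : Type) (w : seq I)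
    (F : I -> G) :
  {morph f : x y / (x * y)%g >-> x + y} ->
  f (\prod_(i <- w) F i)%g = \sum_(i <- w) f (F i).
Proof. by move=> fM; apply: (big_morph f fM (hom1 fM)). Qed.

Lemma hom_intexp (f : G -> int) (x : G) (n : int) :
  {morph f : x y / (x * y)%g >-> x + y} -> f (intexp x n) = n * f x.
Proof.
move=> fM; have fX m : f (x ^+ m)%g = m%:Z * f x.
  elim: m => [|m IHm]; first by rewrite hom1 // mul0r.
  by rewrite expgS fM IHm intS mulrDl mul1r.
case: n => n /=; first exact: fX.
apply: (addIr (f (x ^+ n.+1)%g)).
by rewrite -fM mulVg hom1 // fX NegzE mulNr addNr.
Qed.

(** The range of [f] consists of the multiples of its least positive element
    [d], so dividing by [d] makes [f] surjective. *)
Lemma surjective_int_hom (f : G -> int) (g : G) :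
  {morph f : x y / (x * y)%g >-> x + y} -> f g <> 0 ->
  has_infinite_cyclic_quotient G.
Proof.
move=> fM fg0.
pose P n := `[< (0 < n)%N /\ exists x, f x = n%:Z >].
have exP : exists n, P n.
  exists `|f g|%N; apply/asboolP; split; first by rewrite absz_gt0; exact/eqP.
  by exists (intexp g (sgz (f g))); rewrite hom_intexp // -abszEsg.
have [d /asboolP[d_gt0 [g0 fg0E]] dmin] := ex_minnP exP.
have d_neq0 : d%:Z != 0 by rewrite eqz_nat -lt0n.
have dvdf x : (d%:Z %| f x)%Z.
  apply/dvdz_mod0P; apply: contrapT => /eqP r_neq0.
  pose y := (x * intexp g0 (- (f x %/ d)%Z))%g.
  have fyE : f y = (f x %% d)%Z.
    by rewrite fM hom_intexp // fg0E {1}(divz_eq (f x) d); ring.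
  have fy_gt0 : 0 < f y by rewrite lt_neqAle eq_sym fyE r_neq0 modz_ge0.
  have /dmin : P `|f y|%N.
    apply/asboolP; split; first by rewrite absz_gt0 gt_eqF.
    by exists y; rewrite gtz0_abs.
  by apply/negP; rewrite -ltnNge -ltz_nat gtz0_abs // fyE ltz_pmod.
exists (fun x => (f x %/ d)%Z); split=> [x y|].
  by rewrite fM divzDl.
apply/seteqP; split=> // n _; exists (intexp g0 n) => //.
by rewrite hom_intexp // fg0E mulzK.
Qed.

(** The value of the new homomorphism on a word in the generators is the sum of
    the integers [c] over its letters.  Two words for the same element have
    the same image under [phi], so the difference of their letter counts is a
    relation between the values of [phi], which [c] kills. *)
Lemma int_hom_of_real_hom (R : realType) (S : seq G) (phi : G -> R) (g : G) :
  generates S -> {morph phi : x y / (x * y)%g >-> x + y} -> phi g <> 0 ->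
  has_infinite_cyclic_quotient G.
Proof.
move=> Sgen phiM phig0; pose k := size S; pose e i := nth 1%g S i.
pose prod (w : seq nat) := (\prod_(i <- w) e i)%g.
have words x : exists w, all (ltn^~ k) w /\ x = prod w.
  by have [w wk xE] := Sgen x; exists w.
have [W /all_and2[Wk WE]] := choice words.
pose r i := phi (e i).
have phi_prod w : phi (prod w) = \sum_(i <- w) r i by exact: hom_prod.
have [|c [[j lt_jk cj0] cP]] := @integer_functional R k r.
  apply: contrapT => nr; apply: phig0; rewrite (WE g) phi_prod.
  rewrite big1_seq // => i /andP[_ iW]; apply/eqP/negPn/negP => ri; apply: nr.
  by exists i => //; exact: (allP (Wk g)).
have wd w w' : all (ltn^~ k) w -> all (ltn^~ k) w' ->
    phi (prod w) = phi (prod w') -> \sum_(i <- w) c i = \sum_(i <- w') c i.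
  move=> wk w'k; rewrite !phi_prod !(big_count _ wk) !(big_count _ w'k).
  move=> /eqP; rewrite -subr_eq0 -sumrB => /eqP eq_r.
  have c0 := cP (fun i => (count_mem i w)%:Z - (count_mem i w')%:Z).
  apply/eqP; rewrite -subr_eq0 -sumrB; apply/eqP.
  have natM (n : nat) (x : int) : n%:Z * x = x *+ n by rewrite -mulr_natl natz.
  apply: etrans (c0 _); first by apply: eq_bigr => i _; rewrite mulrBl !natM.
  apply: etrans eq_r; apply: eq_bigr => i _.
  by rewrite rmorphB /= mulrBl !mulr_natl.
apply: (@surjective_int_hom (fun x => \sum_(i <- W x) c i) (e j)) => [x y|].
  rewrite -big_cat; apply: wd; rewrite ?all_cat ?Wk // -WE /prod big_cat.
  by congr phi; congr (_ * _)%g; exact: WE.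
rewrite (@wd _ [:: j]) //=; first by rewrite big_seq1; exact/eqP.
- by rewrite lt_jk.
- by rewrite -WE /prod big_seq1.
Qed.

End IntegerQuotient.

(** * Invariant probabilities and recurrence *)

Lemma borel_open (X : ptopologicalType) (A : set X) :
  open A -> measurable (A : set (borelType X)).
Proof. by move=> oA; exact: sub_gen_smallest. Qed.

Lemma continuous_borel_measurable (X Y : ptopologicalType) (f : X -> Y) :
  continuous f ->
  measurable_fun [set: borelType X] (f : borelType X -> borelType Y).
Proof.
move=> /continuousP fc.
apply: (@measurability _ _ (borelType X) (borelType Y) _ _ (@open Y)) => //.
by move=> _ [A oA <-]; rewrite setTI; apply: borel_open; exact: fc.
Qed.

Lemma subtype_compact (T : topologicalType) (K : set T) :
  compact K -> compact [set: K].
Proof.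
move=> cK F FF _.
have FK : (@set_val T K @ F) K.
  rewrite /fmap /=.
  by apply: filterS (@filterT _ F _) => x _; exact: set_valP.
have [p [Kp clp]] := cK _ (fmap_proper_filter _ FF) FK.
pose x : K := exist _ p (mem_set Kp).
exists x; split=> // A B FA [_ [[U oU <-] Ux sUB]].
have [||_ [[a Aa <-] Ua]] := clp (@set_val T K @` A) U.
- by rewrite nbhs_simpl /=; apply: filterS FA => a Aa; exists a.
- exact: open_nbhs_nbhs.
by exists a; split=> //; exact: sUB.
Qed.

Lemma subtype_hausdorff (T : topologicalType) (K : set T) :
  hausdorff_space T -> hausdorff_space K.
Proof.
move=> hT p q clpq; apply/val_inj/hT => A B nA nB.
have cval := @initial_continuous K T set_val.
have [a [Aa Ba]] := clpq _ _ (cval _ _ nA) (cval _ _ nB).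
by exists (set_val a).
Qed.

(** Amenability is applied to the subspace [K], and the measure obtained there
    is pushed forward to the ambient space. *)
Lemma invariant_probability_on (R : realType) (G : groupType)
    (T : ptopologicalType) (act : G -> T -> T) (K : set T) :
  amenable R G -> hausdorff_space T -> is_continuous_action act ->
  compact K -> K !=set0 -> (forall g x, K x -> K (act g x)) ->
  exists mu : probability (borelType T) R,
    @invariant_measure R G _ (borelType T) act mu /\ mu (~` K) = 0%E.
Proof.
move=> amG hT [[act1 actM] actC] cK [x0 Kx0] Kact.
pose X : ptopologicalType := HB.pack (set_type K)
  (isPointed.Build (set_type K) (exist _ x0 (mem_set Kx0))).
have Kmem (x : K) : K (val x) by case: x => x /= /set_mem.
pose aX (g : G) (x : X) : X :=
  exist _ (act g (val x)) (mem_set (Kact g _ (Kmem x))).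
have valC : continuous (val : X -> T).
  exact: (@initial_continuous K T set_val).
have [|||mu muI] := amG X aX.
- exact: (subtype_compact cK).
- exact: (@subtype_hausdorff T K hT).
- split; first split=> [x|g h x]; first by apply/val_inj/act1.
    by apply/val_inj/actM.
  move=> g; apply: (@continuous_comp_initial _ _ _ (val : X -> T)) => x.
  by apply: (@continuous_comp _ _ _ (val : X -> T) (act g));
    [exact: valC|exact: actC].
have valM := continuous_borel_measurable valC.
pose v : {mfun borelType X >-> borelType T} := HB.pack
  (val : borelType X -> borelType T) (isMeasurableFun.Build _ _ _ _ _ valM).
exists (distribution mu v); split=> [g A mA|].
  rewrite /distribution /pushforward /=.
  have := muI g (v @^-1` A); apply.
  by rewrite -[_ @^-1` _]setTI; exact: (valM measurableT A mA).
have vK : v @^-1` (~` K) = set0.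
  by apply/seteqP; split=> // x /=; apply; exact: Kmem.
exact: etrans (congr1 mu vK) (measure0 mu).
Qed.

Lemma disjoint_equal_measure0 d (X : measurableType d) (R : realType)
    (mu : probability X R) (F : nat -> set X) :
  (forall n, measurable (F n)) -> trivIset setT F ->
  (forall n, mu (F n) = mu (F 0%N)) -> mu (F 0%N) = 0%E.
Proof.
move=> mF tF muF.
have fin : mu (F 0%N) \is a fin_num by exact: fin_num_measure.
suff le0 : fine (mu (F 0%N)) <= 0.
  by apply/eqP; rewrite eq_le measure_ge0 andbT -(fineK fin) lee_fin.
apply: (@le0_of_mulrn_bounded _ _ 1) => k.
have : (mu (\big[setU/set0]_(i < k) F i) <= 1)%E.
  by apply: probability_le1; exact: bigsetU_measurable.
rewrite (@measure_bigsetU_ord _ _ _ mu k xpredT (F \o val)) //=; last first.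
  by move=> i j _ _ ij; apply/val_inj/tF.
under eq_bigr => i _ do rewrite muF -(fineK fin).
by rewrite sumEFin sumr_const card_ord lee_fin mulr_natl.
Qed.

(** The preimages under the iterates of [T] of the set [W] of the points of [E]
    that never return to [E] are disjoint and have equal measures. *)
Lemma poincare_recurrence d (X : measurableType d) (R : realType)
    (mu : probability X R) (T : X -> X) (E : set X) :
  measurable_fun setT T ->
  (forall A, measurable A -> mu (T @^-1` A) = mu A) -> measurable E ->
  mu.-negligible [set x | E x /\ forall n, (0 < n)%N -> ~ E (iter n T x)].
Proof.
move=> Tm muT mE; set W := [set x | _].
have mT A : measurable A -> measurable (T @^-1` A).
  by move=> mA; rewrite -[_ @^-1` _]setTI; exact: Tm.
have iterP n A : measurable A ->
    measurable (iter n T @^-1` A) /\ mu (iter n T @^-1` A) = mu A.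
  elim: n A => // n IHn A mA.
  rewrite -[iter n.+1 T @^-1` A]/(iter n T @^-1` (T @^-1` A)).
  by have [? ->] := IHn _ (mT _ mA); rewrite muT.
have mW : measurable W.
  rewrite (_ : W = E `\` \bigcup_n iter n.+1 T @^-1` E).
    apply: measurableD => //; apply: bigcup_measurable => n _.
    exact: (iterP n.+1 E mE).1.
  apply/seteqP; split=> x /= [Ex Wx]; split=> //.
    by move=> [n _]; exact: Wx.
  by case=> // n _ En; apply: Wx; exists n.
pose F n := iter n T @^-1` W.
apply/negligibleP => //; apply: (@disjoint_equal_measure0 _ _ _ mu F).
- by move=> n; exact: (iterP n W mW).1.
- have disj i j x : (i < j)%N -> F i x -> ~ F j x.
    move=> lt_ij [_ Fi] [Ej _]; apply: (Fi (j - i)%N); first by rewrite subn_gt0.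
    by rewrite -iterD subnK // ltnW.
  move=> i j _ _ [x [Fi Fj]]; have [lt_ij|lt_ji|//] := ltngtP i j.
    by case: (disj _ _ _ lt_ij Fi Fj).
  by case: (disj _ _ _ lt_ji Fj Fi).
- by move=> n; exact: (iterP n W mW).2.
Qed.

Lemma ae_exists d (X : measurableType d) (R : realType)
    (mu : probability X R) (P : X -> Prop) :
  (\forall x \ae mu, P x) -> exists x, P x.
Proof.
move=> aeP; apply: contrapT => nP.
have := @probability_setT _ _ _ mu; rewrite (measure_negligible _ _) //.
  by move=> /eqP; rewrite eq_sym onee_eq0.
by apply: negligibleS aeP => x _ /= Px; apply: nP; exists x.
Qed.

(** * The space of cones *)

Definition bool_space (G : Type) : Type := prod_topology (fun _ : G => bool).

HB.instance Definition _ (G : Type) := Pointed.on (bool_space G).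
HB.instance Definition _ (G : Type) := Nbhs.on (bool_space G).
HB.instance Definition _ (G : Type) := Topological.on (bool_space G).

Lemma bool_space_compact (G : eqType) : compact [set: bool_space G].
Proof.
have := @tychonoff G (fun=> bool) _ (fun=> bool_compact).
by congr (compact _); rewrite eqEsubset.
Qed.

Lemma bool_space_hausdorff (G : eqType) : hausdorff_space (bool_space G).
Proof. by apply: hausdorff_product => ?; exact: discrete_hausdorff. Qed.

Lemma eval_continuous (G : eqType) (x : G) :
  continuous (fun C : bool_space G => C x).
Proof. exact: (@proj_continuous G (fun=> bool) x). Qed.

Lemma bool_space_open (G : eqType) (x : G) (b : bool) :
  open [set C : bool_space G | C x = b].
Proof.
have /continuousP := @eval_continuous G x.
by move=> /(_ [set b]); apply; exact: discrete_open.
Qed.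

Lemma bool_space_closed (G : eqType) (x : G) (b : bool) :
  closed [set C : bool_space G | C x = b].
Proof.
rewrite -openC (_ : ~` _ = [set C : bool_space G | C x = ~~ b]).
  exact: bool_space_open.
by apply/seteqP; split=> C /=; case: (C x) b => -[].
Qed.

Section ConeSpace.
Variable G : groupType.

Definition conj_action (g : G) (C : bool_space G) : bool_space G :=
  fun x => C (x ^ g)%g.

Lemma conj_action_continuous : is_continuous_action conj_action.
Proof.
split; first split=> [C|g h C].
- by apply/funext => x; rewrite /conj_action conjg1.
- by apply/funext => x; rewrite /conj_action conjgM.
move=> g C; apply/cvg_sup => x; move: C.
apply/(@continuousP _ (initial_topology (fun C : bool_space G => C x))).
move=> _ [B oB <-].
have /continuousP := @eval_continuous G (x ^ g)%g.
by move=> /(_ B oB).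
Qed.

(** Properness is required to be visible on [S], a condition on finitely many
    values of [C], so that it defines a closed set. *)
Definition proper_cones (S : seq G) : set (bool_space G) :=
  [set C | cone C /\ has (fun x => ~~ C x) S].

Lemma proper_cones_closed S : closed (proper_cones S).
Proof.
pose M := \bigcap_(p in [set: G * G]) ([set C : bool_space G | C p.1 = false]
  `|` [set C | C p.2 = false] `|` [set C | C (p.1 * p.2)%g = true]).
pose T := \bigcap_(x in [set: G])
  ([set C : bool_space G | C x = true] `|` [set C | C x^-1%g = true]).
pose N := [set C : bool_space G | has (fun x => ~~ C x) S].
have -> : proper_cones S = M `&` T `&` N.
  apply/seteqP; split=> C.
    move=> [[CM Ct] CS]; split=> //; split=> [[x y] _ /=|x _]; last exact/orP/Ct.
    have := CM x y; case: (C x) => [|_]; last by left; left.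
    by case: (C y) => [/(_ isT isT)|_]; [right|left; right].
  move=> [[CM Ct] CS]; split=> //; split=> [x y Cx Cy|x]; last exact/orP/Ct.
  by have [[]|] := CM (x, y) I => /=; rewrite ?Cx ?Cy.
apply: closedI; first apply: closedI.
- apply: closed_bigI => p _.
  by do 2?apply: closedU; exact: bool_space_closed.
- by apply: closed_bigI => x _; apply: closedU; exact: bool_space_closed.
rewrite /N; elim: S {N} => [|x S IHS] /=.
  rewrite (_ : mkset _ = set0); first exact: closed0.
  by apply/seteqP; split.
rewrite (_ : mkset _ = [set C : bool_space G | C x = false]
  `|` [set C | has (fun x => ~~ C x) S]).
  by apply: closedU => //; exact: bool_space_closed.
by apply/seteqP; split=> C /=; case: (C x) => //=; [right|left|case].
Qed.

Lemma cone_conj_action g C : cone C -> cone (conj_action g C).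
Proof.
rewrite /conj_action => -[CM Ct]; split=> [x y Cx Cy|x].
  by rewrite conjMg; exact: CM.
by rewrite conjVg; exact: Ct.
Qed.

End ConeSpace.

(** For given [a] and [b], the cones [C] with [~~ C a] that contain all the
    [a ^ (b ^+ n)], [n > 0], are the points of an open set that never return to
    it under conjugation by [b], hence form a null set; and there are countably
    many pairs [(a, b)]. *)
Lemma exists_recurrent_cone (R : realType) (G : groupType) (S : seq G)
    (C0 : G -> bool) :
  amenable R G -> generates S -> cone C0 -> (exists x, ~~ C0 x) ->
  exists C : G -> bool,
    [/\ cone C, recurrent C & exists2 x, x \in S & ~~ C x].
Proof.
move=> amG Sgen coneC0 C0x.
have proper_gen C : cone C -> (exists x, ~~ C x) -> has (fun x => ~~ C x) S.
  move=> coneC [x]; apply: contraR => /hasPn SC.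
  apply: (@generates_ind _ _ (fun x => C x)) Sgen _ _ x => [|x y xS Cy].
    exact: cone1.
  by apply: coneC.1 => //; exact/negPn/SC.
have proper_conj g C : proper_cones S C -> proper_cones S (conj_action g C).
  move=> [coneC /hasP[x xS Cx]]; have coneCg := cone_conj_action g coneC.
  split=> //; apply: proper_gen => //; exists (x ^ g^-1)%g.
  by rewrite /conj_action conjgKV.
have [||mu [muI muK]] := invariant_probability_on amG
  (@bool_space_hausdorff G) (@conj_action_continuous G) _ _ proper_conj.
- have cT := @bool_space_compact G.
  exact: (subclosed_compact (@proper_cones_closed G S) cT (@subsetT _ _)).
- by exists C0; split=> //; exact: proper_gen.
have [[act1 actM] actC] := @conj_action_continuous G.
have iter_conj k b (C : bool_space G) :
    iter k (conj_action b) C = conj_action (b ^+ k)%g C.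
  by elim: k => [|k IHk]; rewrite ?act1 //= IHk expgS actM.
(* An enumeration of [G], with repetitions, through the words in [S]. *)
pose e n : G :=
  (\prod_(i <- odflt [::] (unpickle n : option (seq nat))) nth 1 S i)%g.
have e_surj x : exists n, x = e n.
  by have [w _ ->] := Sgen x; exists (pickle w); rewrite /e pickleK.
pose returns (C : G -> bool) (a b : G) :=
  ~~ C a -> exists2 n, (0 < n)%N & ~~ C (a ^ (b ^+ n))%g.
have aeR :
    \forall C \ae mu, forall m n, returns (C : bool_space G) (e m) (e n).
  apply: ae_foralln => m; apply: ae_foralln => n.
  have mE : measurable
      ([set C | C (e m) = false] : set (borelType (bool_space G))).
    by apply: borel_open; exact: bool_space_open.
  have := @poincare_recurrence _ (borelType (bool_space G)) R mu
    (conj_action (e n)) _ (continuous_borel_measurable (actC (e n)))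
    (muI (e n)) mE.
  apply: negligibleS => C /= /not_implyP[/negbTE Cm noret]; split=> // k k_gt0.
  rewrite iter_conj => Ck.
  by apply: noret; exists k => //; exact/negbT.
have aeK : \forall C \ae mu, proper_cones S C.
  apply/negligibleP; last exact: muK.
  by apply: borel_open; apply: closed_openC; exact: proper_cones_closed.
have aeKR : \forall C \ae mu,
    proper_cones S C /\ forall m n, returns (C : bool_space G) (e m) (e n).
  exact: (@filterI _ _
    (@ae_filter_ringOfSetsType _ (borelType (bool_space G)) R mu)).
have [C [[coneC /hasP CS] Cret]] := ae_exists aeKR.
exists C; split=> // a b; have [m ->] := e_surj a; have [n ->] := e_surj b.
exact: Cret.
Qed.

(** * Actions on the line *)

Lemma translation_action (R : realType) (G : groupType) :
  has_infinite_cyclic_quotient G ->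
  exists act : G -> R -> R,
    is_orientation_preserving_action act /\ nontrivial_action act.
Proof.
move=> [f [fM fsurj]]; exists (fun g x => (f g)%:~R + x).
split; first split.
- split; first split=> [x|g h x]; first by rewrite (hom1 fM) add0r.
    by rewrite fM intrD addrA.
  by move=> g x; apply: cvgD; [exact: cvg_cst|exact: cvg_id].
- by move=> g x y; rewrite ltrD2l.
have [g _ fg1] : range f 1 by rewrite fsurj.
exists g; rewrite fg1 => /(congr1 (@^~ 0)) /eqP.
by rewrite addr0 oner_eq0.
Qed.

Lemma point_cone (R : realType) (G : groupType) (act : G -> R -> R) (x : R) :
  is_orientation_preserving_action act -> cone (fun g => x <= act g x).
Proof.
move=> [[[act1 actM] _] mono]; split=> [g h xg xh|g].
  by rewrite actM (le_trans xg) //; apply: (ltW_homo (mono g)).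
have [//|gx] /= := lerP x (act g x); apply: ltW.
by rewrite -{1}[x]act1 -(mulVg g) actM; exact: mono.
Qed.

Lemma point_cone_proper (R : realType) (G : groupType) (act : G -> R -> R)
    g x :
  is_orientation_preserving_action act -> act g x <> x ->
  exists h, ~~ (x <= act h x).
Proof.
move=> [[[act1 actM] _] mono] /eqP; rewrite neq_lt => /orP[gx|xg].
  by exists g; rewrite -ltNge.
exists g^-1%g; rewrite -ltNge -[ltRHS]act1 -(mulVg g) actM; exact: mono.
Qed.

Theorem theorem1 (R : realType) (G : groupType)
    (hfg : finitely_generated G) (ham : amenable R G) :
  (exists act : G -> R -> R,
      is_orientation_preserving_action act /\ nontrivial_action act) <->
  has_infinite_cyclic_quotient G.
Proof.
split=> [[act [opact [g gnid]]]|]; last exact: translation_action.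
have [S SV Sgen] := exists_generating_seq hfg.
have [x gx] : exists x, act g x <> x.
  apply: contrapT => fix_g; apply/gnid/funext => x; apply: contrapT => gx.
  by apply: fix_g; exists x.
have [C [coneC recC properC]] := exists_recurrent_cone ham Sgen
  (point_cone x opact) (point_cone_proper opact gx).
have [s cofs] := exists_cofinal coneC recC SV Sgen properC.
have [D [coneD conjD cofsD]] := exists_biinvariant_cone coneC recC cofs.
have [phi [phiM phis]] := holder R coneD conjD cofsD.
exact: (int_hom_of_real_hom Sgen phiM phis).
Qed.
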